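(* Let $n_1\le n_2$, $m$ and $k\le n_1$ be positive integers, let $\mathcal{A}:\mathbb{R}^{n_1\times n_2}\to\mathbb{R}^m$ be a linear operator, and suppose $\mathcal{A}$ satisfies the $\Delta$-Spherical Section Property with $\Delta>4k$. Let $X_0\in\mathbb{R}^{n_1\times n_2}$ and let $X^*\in\mathbb{R}^{n_1\times n_2}$ satisfy $\mathcal{A}(X^* )=\mathcal{A}(X_0)$ and $\|X^*\|_\star\le\|X_0\|_\star$. Then $$\|X^*-X_0\|_\star\le C\,\|X_0-X_0^k\|_\star,\qquad C=\frac{2}{1-2\sqrt{k/\Delta}}.$$
   Context: For $X\in\mathbb{R}^{n_1\times n_2}$ with singular values $\sigma_1(X)\ge\dots\ge\sigma_{n_1}(X)$: $\|X\|_\star=\sum_i\sigma_i(X)$ is the nuclear norm, $\|X\|_F=(\sum_i\sigma_i(X)^2)^{1/2}$ is the Frobenius norm, and $X^k$ is the matrix obtained by keeping the first $k$ terms (those of the $k$ largest singular values) in a singular value decomposition of $X$. The operator $\mathcal{A}$ satisfies the $\Delta$-Spherical Section Property if $\|Z\|_\star^2/\|Z\|_F^2\ge\Delta$ for every nonzero $Z$ in the null space of $\mathcal{A}$. *)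

(* Defs.v *)
From mathcomp Require Import all_boot all_order all_algebra.
From mathcomp Require Import reals polyrcf.

Set Implicit Arguments.
Unset Strict Implicit.
Unset Printing Implicit Defensive.

Import Order.TTheory GRing.Theory Num.Theory.
Local Open Scope ring_scope.

(* The square roots of the n1 eigenvalues of X X^T, counted with multiplicity
   and listed in decreasing order.  X X^T is symmetric positive semidefinite,
   so its characteristic polynomial splits over R with nonnegative roots.  For
   n1 <= n2 these are the n1 = min(n1, n2) singular values of X. *)
Definition singular_values (R : realType) (n1 n2 : nat)
    (X : 'M[R]_(n1, n2)) : seq R :=
  let p := char_poly (X *m X^T) in
  sort >=%R (flatten [seq nseq (mup x p) (Num.sqrt x) | x <- rootsR p]).

(* Indices start at 0: singular_value X 0 is the largest one. *)
Definition singular_value (R : realType) (n1 n2 : nat)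
    (X : 'M[R]_(n1, n2)) (i : nat) : R := (singular_values X)`_i.

Definition nuclear_norm (R : realType) (n1 n2 : nat)
    (X : 'M[R]_(n1, n2)) : R :=
  \sum_(i < n1) singular_value X i.

Definition frobenius_norm (R : realType) (n1 n2 : nat)
    (X : 'M[R]_(n1, n2)) : R :=
  Num.sqrt (\sum_(i < n1) singular_value X i ^+ 2).

(* The sum of the first k terms sigma_i u_i v_i^T, where u_i and v_i are the
   columns of U and V; all n1 terms are taken when k = n1. *)
Definition svd_sum (R : realType) (n1 n2 : nat) (X : 'M[R]_(n1, n2))
    (U : 'M[R]_n1) (V : 'M[R]_(n2, n1)) (k : nat) : 'M[R]_(n1, n2) :=
  \sum_(i < n1 | (i < k)%N) singular_value X i *: (col i U *m (col i V)^T).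

(* Singular value decomposition of X for n1 <= n2, in the form with n1 rank-one
   terms: the columns of U and the columns of V are orthonormal families. *)
Definition is_svd (R : realType) (n1 n2 : nat) (X : 'M[R]_(n1, n2))
    (U : 'M[R]_n1) (V : 'M[R]_(n2, n1)) : Prop :=
  [/\ U^T *m U = 1%:M, V^T *m V = 1%:M & X = svd_sum X U V n1].

(* X^k depends on the chosen decomposition when the k-th and (k+1)-st singular
   values are equal and positive, hence a relation rather than a function. *)
Definition is_svd_truncation (R : realType) (n1 n2 : nat)
    (X : 'M[R]_(n1, n2)) (k : nat) (Xk : 'M[R]_(n1, n2)) : Prop :=
  exists (U : 'M[R]_n1) (V : 'M[R]_(n2, n1)),
    is_svd X U V /\ Xk = svd_sum X U V k.

Definition spherical_section (R : realType) (n1 n2 m : nat)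
    (A : {linear 'M[R]_(n1, n2) -> 'cV[R]_m}) (Delta : R) : Prop :=
  forall Z : 'M[R]_(n1, n2), Z != 0 -> A Z = 0 ->
    Delta <= nuclear_norm Z ^+ 2 / frobenius_norm Z ^+ 2.

(* Main.v *)
Require Import Defs.
From mathcomp Require Import all_boot all_order all_algebra.
From mathcomp Require Import perm.
From mathcomp Require Import reals polyrcf complex.
From mathcomp Require Import ring lra zify.
Import Order.TTheory GRing.Theory Num.Theory.
Local Open Scope ring_scope.

Set Implicit Arguments.
Unset Strict Implicit.
Unset Printing Implicit Defensive.

(** Put W = Xstar - X0, so that A W = 0, and write s_i for singular values.
    Everything rests on the perturbation inequality

      sum_i |s_i(X) - s_i(Y)| <= ||X - Y||_*

    ([singular_value_perturbation]).  Applied to X0 and - W, whose difference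
    is Xstar, together with ||Xstar||_* <= ||X0||_*, it gives

      sum_(i < k) (s_i(X0) - s_i(W)) + sum_(i >= k) (s_i(W) - s_i(X0))
        <= sum_i s_i(X0),

    that is, ||W||_* <= 2 sum_(i < k) s_i(W) + 2 sum_(i >= k) s_i(X0).  The last
    sum is ||X0 - X0^k||_* ([nuclear_norm_svd_tail]).  By Cauchy-Schwarz the
    first one is at most sqrt k ||W||_F, which the spherical section property
    bounds by sqrt (k / Delta) ||W||_*.  As 2 sqrt (k / Delta) < 1, the term in
    ||W||_* can be moved to the left and divided out.

    The perturbation inequality is first proved for the eigenvalues of
    symmetric matrices ([eigenvalue_perturbation]).  Let D+ and D- be the
    positive and negative parts of S - T, and let C = T + D+ = S + D-.  Since C
    dominates both S and T as a quadratic form, its ordered eigenvalues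
    c_i dominate a_i and b_i ([eigenvalue_monotone]), so that

      sum_i |a_i - b_i| <= sum_i ((c_i - a_i) + (c_i - b_i))
                         = tr D- + tr D+ = sum_i |d_i|,

    where the d_i are the eigenvalues of S - T.
    Singular values are reached through the symmetric dilation
    [[0, X], [X^T, 0]], whose eigenvalues are the s_i, the - s_i and n2 - n1
    zeros ([dilation_spectrum]).

    Spectra enter as factorizations of characteristic polynomials into linear
    factors indexed by a row vector.  This is the form in which singular values
    are given, and a symmetric matrix can be diagonalized with its eigenvalues
    in whatever order such a factorization lists them
    ([symmetric_diagonalization_with]). *)

(** * Orthogonal diagonalization of symmetric matrices *)

Lemma sqnorm_row (R : pzSemiRingType) n (v : 'rV[R]_n) :
  (v *m v^T) 0 0 = \sum_j v 0 j ^+ 2.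
Proof. by rewrite mxE; apply: eq_bigr => j _; rewrite mxE expr2. Qed.

Lemma sqnorm_row_gt0 (R : realDomainType) n (v : 'rV[R]_n) :
  v != 0 -> 0 < (v *m v^T) 0 0.
Proof.
rewrite sqnorm_row lt_def sumr_ge0 ?andbT => [v0|j _]; last exact: sqr_ge0.
apply: contraNneq v0 => /psumr_eq0P v0; apply/eqP/rowP => j.
by rewrite mxE; apply/eqP; rewrite -sqrf_eq0 v0 // => i _; apply: sqr_ge0.
Qed.

(** Over R[i] there is an eigenvector w, of eigenvalue z; let w' be its conjugate.
    As S is real symmetric, z (w w'^T) = w S w'^T = conj z (w w'^T), so z is
    real.  It is then a root over R of the characteristic polynomial of S, and
    has a real eigenvector. *)
Lemma symmetric_unit_eigenvector (R : rcfType) n (S : 'M[R]_n.+1) : S^T = S ->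
  exists a, exists2 v : 'rV[R]_n.+1, v *m v^T = 1%:M & v *m S = a *: v.
Proof.
move=> symS; set f := real_complex R.
have [z zS] := eigenvalue_closed (map_mx f S) (ltn0Sn n).
have /eigenvalueP[w wS w0] := zS.
set w' := map_mx (@conjc R) w.
have w'S : w' *m map_mx f S = conjc z *: w'.
  rewrite /w' -map_mxZ -wS map_mxM; congr (_ *m _).
  by apply/matrixP => i j; rewrite !mxE; apply/esym; apply: conjc_real.
have ww0 : (w *m w'^T) 0 0 != 0.
  rewrite mxE psumr_neq0 => [|j _]; last by rewrite !mxE mulcJ_ge0.
  have /rV0Pn[j wj] := w0; apply/hasP; exists j; first exact: mem_index_enum.
  by rewrite !mxE lt_def mulcJ_ge0 andbT mulf_neq0 ?conjc_eq0.
have z_real : z = conjc z.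
  apply: (mulIf ww0); transitivity ((w *m map_mx f S *m w'^T) 0 0).
    by rewrite wS -scalemxAl [RHS]mxE.
  rewrite -mulmxA -[X in _ *m (X *m _)]trmxK map_trmx symS -trmx_mul w'S.
  by rewrite linearZ /= -scalemxAr [LHS]mxE.
have [a az] : exists a, z = f a.
  case: z z_real {zS wS w'S} => a b [] ab; exists a; congr Complex.
  by apply/eqP; rewrite -eqNr -ab.
have /eigenvalueP[v vS v0] : eigenvalue S a.
  move: zS; rewrite az !eigenvalue_root_char -map_char_poly.
  by rewrite (fmorph_root (real_complex R)).
have vv := sqnorm_row_gt0 v0; set c := (v *m v^T) 0 0 in vv.
exists a; exists ((Num.sqrt c)^-1 *: v).
  rewrite linearZ /= -scalemxAl -scalemxAr [v *m v^T]mx11_scalar -/c.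
  rewrite !scale_scalar_mx mulrA -invfM -expr2 sqr_sqrtr ?ltW //.
  by rewrite mulVf // gt_eqF.
by rewrite -scalemxAl vS !scalerA mulrC.
Qed.

(** The reflection in the hyperplane orthogonal to w = v - u exchanges the unit
    vectors u and v.  It completes a unit eigenvector to an orthonormal basis in
    the diagonalization below. *)
Lemma householder (R : realFieldType) n (u v : 'rV[R]_n) :
  u *m u^T = 1%:M -> v *m v^T = 1%:M ->
  exists2 H : 'M[R]_n, H *m H^T = 1%:M & u *m H = v.
Proof.
move=> uu vv; have [->|] := eqVneq u v.
  by exists 1%:M; rewrite ?trmx1 mulmx1.
rewrite eq_sym -subr_eq0 => /sqnorm_row_gt0; set w := v - u; set c := _ 0 0.
move=> c_gt0; have c0 : c != 0 by rewrite gt_eqF.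
have ww : w *m w^T = c%:M by rewrite [LHS]mx11_scalar.
have uw : u *m w^T = (- (c / 2))%:M.
  have uv : v *m u^T = u *m v^T by rewrite [LHS]mx11_scalar [RHS]mx11_scalar
    -[v *m _]trmxK trmx_mul trmxK [(_^T) 0 0]mxE.
  have : w *m w^T = - 2 *: (u *m w^T).
    rewrite /w linearB /= !(mulmxBl, mulmxBr) uu vv uv.
    by move: (u *m v^T) => P; apply/matrixP => i j; rewrite !mxE; ring.
  rewrite ww => /(congr1 (fun M => (- 2)^-1 *: M)).
  rewrite scalerA mulVf ?oppr_eq0 ?pnatr_eq0 // scale1r => <-.
  by rewrite scale_scalar_mx; congr (_%:M); field.
have uP : u *m (w^T *m w) = - (c / 2) *: (v - u).
  by rewrite mulmxA uw mul_scalar_mx.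
have : (w^T *m w)^T = w^T *m w by rewrite trmx_mul trmxK.
have : (w^T *m w) *m (w^T *m w) = c *: (w^T *m w).
  by rewrite -mulmxA (mulmxA w) ww mul_scalar_mx -scalemxAr.
move: (w^T *m w) uP => P uP PP symP.
exists (1%:M - (2 / c) *: P).
  rewrite [(_ - _)^T]linearB /= [(_ *: _)^T]linearZ /= symP trmx1.
  rewrite mulmxBl !mulmxBr !(mul1mx, mulmx1).
  rewrite -scalemxAl -scalemxAr PP !scalerA.
  rewrite (_ : 2 / c * (2 / c) * c = 2 / c + 2 / c); last by field.
  by move: P {uP PP symP} => P; apply/matrixP => i j; rewrite !mxE; ring.
rewrite mulmxBr mulmx1 -scalemxAr uP scalerA.
by rewrite (_ : _ * _ = -1); [rewrite scaleN1r opprK addrC subrK | field].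
Qed.

(** In an orthonormal basis starting with a unit eigenvector, the first row of
    the matrix is (a, 0, ..., 0); by symmetry so is its first column, and the
    remaining block is diagonalized by induction. *)
Theorem symmetric_diagonalization (R : rcfType) n (S : 'M[R]_n) : S^T = S ->
  exists2 U : 'M[R]_n, U *m U^T = 1%:M &
    exists d : 'rV[R]_n, S = U^T *m diag_mx d *m U.
Proof.
elim: n S => [|n IHn] S symS.
  exists 1%:M; first by rewrite trmx1 mulmx1.
  by exists 0; rewrite [LHS]flatmx0 [RHS]flatmx0.
have [a [v vv vS]] := symmetric_unit_eigenvector symS.
pose e : 'rV[R]_(1 + n) := row_mx 1%:M 0.
have ee : e *m e^T = 1%:M.
  by rewrite tr_row_mx mul_row_col trmx1 trmx0 mulmx0 addr0 mulmx1.
have [H HH eH] := householder ee vv; have HtH := mulmx1C HH.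
pose T : 'M[R]_(1 + n) := H *m S *m H^T.
have symT : T^T = T by rewrite /T !trmx_mul trmxK symS mulmxA.
have eT : e *m T = a *: e.
  rewrite /T !mulmxA eH vS -scalemxAl; congr (_ *: _).
  by rewrite -eH -mulmxA HH mulmx1.
have [T11 T12] : ulsubmx T = a%:M /\ ursubmx T = 0.
  move: eT; rewrite -[T]submxK mul_row_block !mul1mx !mul0mx !addr0.
  rewrite scale_row_mx scaler0 => /eq_row_mx[].
  by rewrite !(block_mxKul, block_mxKur) scalemx1.
have T21 : dlsubmx T = 0 by rewrite -[dlsubmx T]trmxK trmx_dlsub symT T12 trmx0.
have [|U UU [d Td]] := IHn (drsubmx T); first by rewrite trmx_drsub symT.
pose V : 'M[R]_(1 + n) := block_mx 1%:M 0 0 U.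
have VV : V *m V^T = 1%:M.
  rewrite tr_block_mx mulmx_block !(trmx1, trmx0, mulmx0, mul0mx, mulmx1, mul1mx).
  by rewrite !(addr0, add0r) UU -scalar_mx_block.
exists (V *m H).
  by rewrite trmx_mul mulmxA -[V *m H *m _]mulmxA HH mulmx1.
exists (row_mx a%:M d : 'rV_(1 + n)).
have TE : T = V^T *m diag_mx (row_mx a%:M d) *m V.
  rewrite -[T]submxK T11 T12 T21 Td diag_mx_row tr_block_mx !mulmx_block.
  rewrite !(trmx1, trmx0, mulmx0, mul0mx, mulmx1, mul1mx, addr0, add0r).
  congr block_mx; apply/matrixP => i j; by rewrite !ord1 !mxE.
rewrite trmx_mul !mulmxA -(mulmxA H^T) -(mulmxA H^T) -TE /T.
by rewrite !mulmxA HtH mul1mx -mulmxA HtH mulmx1.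
Qed.

Lemma orthogonal_diag_entry (R : pzSemiRingType) n (U : 'M[R]_n) (d : 'rV_n) k l :
  (U^T *m diag_mx d *m U) k l = \sum_i U i k * d 0 i * U i l.
Proof. by rewrite mul_mx_diag mxE; apply: eq_bigr => i _; rewrite !mxE. Qed.

Lemma orthogonal_diag_form (R : comPzRingType) n (U : 'M[R]_n) (d x : 'rV_n) :
  (x *m (U^T *m diag_mx d *m U) *m x^T) 0 0
  = \sum_i d 0 i * (x *m U^T) 0 i ^+ 2.
Proof.
rewrite !mulmxA -mulmxA mul_mx_diag mxE; apply: eq_bigr => i _.
by rewrite -[U *m x^T]trmxK trmx_mul trmxK !mxE; ring.
Qed.

Lemma orthogonal_diag_trace (R : comPzRingType) n (U : 'M[R]_n) (d : 'rV_n) :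
  U *m U^T = 1%:M -> \tr (U^T *m diag_mx d *m U) = \sum_i d 0 i.
Proof. by move=> UU; rewrite mxtrace_mulC mulmxA UU mul1mx mxtrace_diag. Qed.

Lemma orthogonal_diag_char_poly (R : comNzRingType) n (U : 'M[R]_n) (d : 'rV_n) :
  U^T *m U = 1%:M ->
  char_poly (U^T *m diag_mx d *m U) = \prod_i ('X - (d 0 i)%:P).
Proof.
move=> UU; pose P : 'M[{poly R}]_n := map_mx polyC U.
have PP : P^T *m P = 1%:M by rewrite map_trmx -map_mxM UU map_mx1.
have -> : \prod_i ('X - (d 0 i)%:P) = char_poly (diag_mx d).
  rewrite char_poly_trig ?diag_mx_is_trig //.
  by apply: eq_bigr => i _; rewrite !mxE eqxx.
have dP : \det P^T * \det P = 1 by rewrite -det_mulmx PP det1.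
rewrite /char_poly -[RHS]mul1r -dP mulrAC -!det_mulmx; congr (\det _).
rewrite /char_poly_mx mulmxBr mulmxBl !map_mxM -map_trmx -/P.
by rewrite mul_mx_scalar -scalemxAl PP scalemx1.
Qed.

(** Two factorizations of the characteristic polynomial differ by a permutation
    of the factors, and permuting the rows of U permutes the eigenvalues. *)
Lemma symmetric_diagonalization_with (R : rcfType) n (S : 'M[R]_n) (a : 'rV_n) :
  S^T = S -> char_poly S = \prod_i ('X - (a 0 i)%:P) ->
  exists2 U : 'M[R]_n, U *m U^T = 1%:M & S = U^T *m diag_mx a *m U.
Proof.
move=> symS Sa; have [U UU [d Sd]] := symmetric_diagonalization symS.
have : perm_eq [tuple a 0 i | i < n] [tuple d 0 i | i < n].
  apply: prod_XsubC_eq; rewrite !big_tuple.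
  under eq_bigr do rewrite tnth_mktuple.
  under [RHS]eq_bigr do rewrite tnth_mktuple.
  by rewrite -Sa Sd (orthogonal_diag_char_poly _ (mulmx1C UU)).
case/tuple_permP => p ap.
have {}ap i : a 0 i = d 0 (p i).
  move/(congr1 (fun s => nth 0 s i)): ap.
  by rewrite -!tnth_nth !tnth_mktuple.
exists (row_perm p U); first by rewrite row_permE trmx_mul mulmxA -(mulmxA _ U)
  UU mulmx1 tr_perm_mx -perm_mxM mulgV perm_mx1.
apply/matrixP => k l; rewrite Sd !orthogonal_diag_entry (reindex_inj (@perm_inj _ p)).
by apply: eq_bigr => i _; rewrite !mxE ap.
Qed.

Lemma sorted_spectrum (R : rcfType) n (S : 'M[R]_n) : S^T = S ->
  exists2 a : 'rV[R]_n, {homo a 0 : i j / (i <= j)%N >-> j <= i} &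
    char_poly S = \prod_i ('X - (a 0 i)%:P).
Proof.
move=> symS; have [U UU [d ->]] := symmetric_diagonalization symS.
pose s := sort >=%R [tuple d 0 i | i < n].
have sz_s : size s = n by rewrite size_sort size_tuple.
exists (\row_i s`_i) => [i j ij|].
  rewrite !mxE; apply: (sorted_leq_nth ge_trans ge_refl) => //.
  - exact/sort_sorted/ge_total.
  - by rewrite inE sz_s.
  - by rewrite inE sz_s.
rewrite (orthogonal_diag_char_poly _ (mulmx1C UU)).
under [RHS]eq_bigr do rewrite mxE.
rewrite -[in RHS]sz_s.
transitivity (\prod_(x <- s) ('X - x%:P)); last first.
  by rewrite (big_nth 0) big_mkord.
have s_perm : perm_eq s [tuple d 0 i | i < n] by rewrite perm_sort.
rewrite (perm_big _ s_perm) big_tuple.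
by apply: eq_bigr => i _; rewrite tnth_mktuple.
Qed.

(** * Perturbation of the eigenvalues of symmetric matrices *)

(** The i-th ordered eigenvalue is a max-min of the quadratic form.  Concretely,
    some x <> 0 has no components along the eigenvectors of S of index above i
    nor along those of T of index below i; then
    a_i |x|^2 <= x S x^T <= x T x^T <= c_i |x|^2. *)
Lemma eigenvalue_monotone (R : rcfType) n (S T : 'M[R]_n) (a c : 'rV[R]_n) :
  S^T = S -> T^T = T ->
  char_poly S = \prod_i ('X - (a 0 i)%:P) ->
  char_poly T = \prod_i ('X - (c 0 i)%:P) ->
  {homo a 0 : i j / (i <= j)%N >-> j <= i} ->
  {homo c 0 : i j / (i <= j)%N >-> j <= i} ->
  (forall x : 'rV_n, (x *m S *m x^T) 0 0 <= (x *m T *m x^T) 0 0) ->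
  forall i, a 0 i <= c 0 i.
Proof.
move=> symS symT Sa Tc a_dec c_dec leST i.
have [U UU SE] := symmetric_diagonalization_with symS Sa.
have [V VV TE] := symmetric_diagonalization_with symT Tc.
(* The orthogonality conditions on x are the columns of x K = 0.  There are only
   n - 1 of them: column i of K is zero, so K is singular. *)
pose K := \matrix_(k, j) if (i < j)%N then U^T k j
                         else if (j < i)%N then V^T k j else 0.
have /eqP/det0P[x x0 xK] : \det K = 0.
  rewrite (expand_det_col K i) big1 // => k _.
  by rewrite mxE ltnn mul0r.
have xU (j : 'I_n) : (i < j)%N -> (x *m U^T) 0 j = 0.
  move=> ij; transitivity ((x *m K) 0 j); last by rewrite xK mxE.
  rewrite [LHS]mxE [RHS]mxE; apply: eq_bigr => k _.
  by rewrite [K _ _]mxE ij.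
have xV (j : 'I_n) : (j < i)%N -> (x *m V^T) 0 j = 0.
  move=> ji; transitivity ((x *m K) 0 j); last by rewrite xK mxE.
  rewrite [LHS]mxE [RHS]mxE; apply: eq_bigr => k _.
  by rewrite [K _ _]mxE ltnNge ltnW //= ji.
have isom (W : 'M[R]_n) : W *m W^T = 1%:M -> \sum_j (x *m W^T) 0 j ^+ 2
    = (x *m x^T) 0 0.
  move=> /mulmx1C WW; rewrite -sqnorm_row trmx_mul trmxK mulmxA.
  by rewrite -(mulmxA x) WW mulmx1.
have xx := sqnorm_row_gt0 x0; rewrite -(ler_pM2r xx).
apply: (@le_trans _ _ ((x *m S *m x^T) 0 0)).
  rewrite SE orthogonal_diag_form -(isom _ UU) mulr_sumr ler_sum // => j _.
  have [ij|ji] := ltnP i j; first by rewrite xU // expr0n !mulr0.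
  by rewrite ler_wpM2r ?sqr_ge0 // a_dec.
apply: le_trans (leST x) _.
rewrite TE orthogonal_diag_form -(isom _ VV) mulr_sumr ler_sum // => j _.
have [ji|ij] := ltnP j i; first by rewrite xV // expr0n !mulr0.
by rewrite ler_wpM2r ?sqr_ge0 // c_dec.
Qed.

Lemma trace_spectrum (R : rcfType) n (S : 'M[R]_n) (a : 'rV[R]_n) :
  S^T = S -> char_poly S = \prod_i ('X - (a 0 i)%:P) -> \tr S = \sum_i a 0 i.
Proof.
move=> symS /(symmetric_diagonalization_with symS)[U UU ->].
exact: orthogonal_diag_trace.
Qed.

(** Comparing both matrices with a common upper bound C turns the sum of absolute
    values into a difference of traces, in which C cancels. *)
Theorem eigenvalue_perturbation (R : rcfType) n (S T : 'M[R]_n) (a b d : 'rV[R]_n) :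
  S^T = S -> T^T = T ->
  char_poly S = \prod_i ('X - (a 0 i)%:P) ->
  char_poly T = \prod_i ('X - (b 0 i)%:P) ->
  char_poly (S - T) = \prod_i ('X - (d 0 i)%:P) ->
  {homo a 0 : i j / (i <= j)%N >-> j <= i} ->
  {homo b 0 : i j / (i <= j)%N >-> j <= i} ->
  \sum_i `|a 0 i - b 0 i| <= \sum_i `|d 0 i|.
Proof.
move=> symS symT Sa Tb STd a_dec b_dec.
have symST : (S - T)^T = S - T by rewrite linearB /= symS symT.
have [W WW STE] := symmetric_diagonalization_with symST STd.
pose part (f : R -> R) := W^T *m diag_mx (map_mx f d) *m W.
have sym_part f : (part f)^T = part f.
  by rewrite /part !trmx_mul trmxK tr_diag_mx mulmxA.
have part_ge0 f (x : 'rV_n) : (forall t, 0 <= f t) -> 0 <= (x *m part f *m x^T) 0 0.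
  move=> f0; rewrite /part orthogonal_diag_form sumr_ge0 // => i _.
  by rewrite mulr_ge0 ?sqr_ge0 // mxE.
pose pos t : R := Num.max t 0; pose neg t : R := Num.max (- t) 0.
have posE t : pos t = t + neg t
  by rewrite /pos /neg; case: (leP t 0); case: (leP (- t) 0); lra.
have normE t : pos t + neg t = `|t|.
  by rewrite /pos /neg; case: ger0P; case: (leP t 0); case: (leP (- t) 0); lra.
pose C := T + part pos.
have symC : C^T = C by rewrite linearD /= symT sym_part.
have CE : C = S + part neg.
  rewrite /C -[S](subrK T) STE addrAC addrC; congr (_ + _).
  rewrite /part -mulmxDl -mulmxDr -raddfD; congr (_ *m diag_mx _ *m _).
  by apply/rowP => i; rewrite !mxE posE.
have [c c_dec Cc] := sorted_spectrum symC.
have a_le_c : forall i, a 0 i <= c 0 i.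
  apply: (eigenvalue_monotone symS symC) => // x.
  rewrite CE mulmxDr mulmxDl [leRHS]mxE lerDl part_ge0 // => t.
  by rewrite le_max lexx orbT.
have b_le_c : forall i, b 0 i <= c 0 i.
  apply: (eigenvalue_monotone symT symC) => // x.
  rewrite /C mulmxDr mulmxDl [leRHS]mxE lerDl part_ge0 // => t.
  by rewrite le_max lexx orbT.
have tr_part f : \tr (part f) = \sum_i f (d 0 i).
  by rewrite orthogonal_diag_trace //; apply: eq_bigr => i _; rewrite mxE.
apply: (@le_trans _ _ (\sum_i ((c 0 i - a 0 i) + (c 0 i - b 0 i)))).
  apply: ler_sum => i _; have := a_le_c i; have := b_le_c i.
  by rewrite ler_norml => ? ?; apply/andP; split; lra.
rewrite big_split /= !sumrB -(trace_spectrum symC Cc) -(trace_spectrum symS Sa).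
rewrite -(trace_spectrum symT Tb).
have -> : \tr C - \tr S = \sum_i neg (d 0 i)
  by rewrite CE mxtraceD tr_part addrC addKr.
have -> : \tr C - \tr T = \sum_i pos (d 0 i)
  by rewrite mxtraceD tr_part addrC addKr.
rewrite -big_split le_eqVlt; apply/orP; left; apply/eqP.
by apply: eq_bigr => i _; rewrite /= addrC normE.
Qed.

(** * Singular values as roots of a characteristic polynomial *)

(** Both sides contain y with multiplicity the order of y as a root: a split
    polynomial determines its multiset of roots. *)
Lemma perm_roots_mup (R : rcfType) (s : seq R) :
  perm_eq (flatten [seq nseq (mup x (\prod_(y <- s) ('X - y%:P))) x
                   | x <- rootsR (\prod_(y <- s) ('X - y%:P))]) s.
Proof.
set p := \prod_(y <- s) _; have p0 : p != 0 by rewrite monic_neq0 // monic_prod_XsubC.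
apply/allP => y _ /=; apply/eqP; rewrite -(mu_prod_XsubC y s) -/p.
rewrite count_flatten -map_comp.
under eq_map do rewrite /= count_nseq.
have mem_rootsR : (y \in rootsR p) = root p y by rewrite -roots_on_rootsR.
rewrite sumnE big_map; have [py|npy] := boolP (root p y); last first.
  rewrite mupNroot // big_seq big1 // => x xp /=.
  by case: eqP => [xy|//]; rewrite -mem_rootsR -xy xp in npy.
rewrite (bigD1_seq y) ?mem_rootsR ?uniq_roots //= eqxx mul1n big1 ?addn0 // => x.
by case: eqP.
Qed.

Section SingularValues.
Variables (R : realType) (n1 n2 : nat).
Implicit Types X Y : 'M[R]_(n1, n2).

Lemma perm_singular_values X (s : seq R) :
  char_poly (X *m X^T) = \prod_(x <- s) ('X - (x ^+ 2)%:P) ->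
  {in s, forall x, 0 <= x} -> perm_eq (singular_values X) s.
Proof.
move=> Xs s_ge0; rewrite /singular_values perm_sort.
set p := char_poly _ in Xs *.
have {}Xs : p = \prod_(y <- [seq x ^+ 2 | x <- s]) ('X - y%:P) by rewrite big_map.
have -> : [seq nseq (mup x p) (Num.sqrt x) | x <- rootsR p]
        = [seq map Num.sqrt t | t <- [seq nseq (mup x p) x | x <- rootsR p]].
  by rewrite -map_comp; apply: eq_map => x /=; rewrite map_nseq.
rewrite -map_flatten; have := perm_roots_mup [seq x ^+ 2 | x <- s].
rewrite /= -Xs => /(perm_map Num.sqrt)/perm_trans; apply.
rewrite -map_comp map_id_in // => x xs /=.
by rewrite sqrtr_sqr ger0_norm // s_ge0.
Qed.

(** The eigenvalues of X X^T are nonnegative, being the squared norms of the rows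
    of U X for an orthogonal U that diagonalizes X X^T. *)
Lemma gram_spectrum X :
  exists2 s : n1.-tuple R, {in s, forall x, 0 <= x} &
    char_poly (X *m X^T) = \prod_(x <- s) ('X - (x ^+ 2)%:P).
Proof.
have [|U UU [d XE]] := @symmetric_diagonalization _ _ (X *m X^T).
  by rewrite trmx_mul trmxK.
have d_ge0 i : 0 <= d 0 i.
  have -> : d 0 i = (U *m X *m (U *m X)^T) i i.
    rewrite trmx_mul mulmxA -(mulmxA U) XE !mulmxA UU mul1mx -mulmxA UU mulmx1.
    by rewrite mxE eqxx.
  by rewrite mxE sumr_ge0 // => j _; rewrite [(_^T) _ _]mxE -expr2 sqr_ge0.
exists [tuple Num.sqrt (d 0 i) | i < n1] => [x /mapP[i _ ->]|].
  exact: sqrtr_ge0.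
rewrite XE (orthogonal_diag_char_poly _ (mulmx1C UU)) big_tuple.
by apply: eq_bigr => i _; rewrite tnth_mktuple sqr_sqrtr.
Qed.

Lemma size_singular_values X : size (singular_values X) = n1.
Proof.
have [s s_ge0 Xs] := gram_spectrum X.
by rewrite (perm_size (perm_singular_values Xs s_ge0)) size_tuple.
Qed.

Lemma singular_value_ge0 X i : 0 <= singular_value X i.
Proof.
have [s s_ge0 Xs] := gram_spectrum X.
have [i_n1|n1_i] := ltnP i (size (singular_values X)).
  by apply: (s_ge0); rewrite -(perm_mem (perm_singular_values Xs s_ge0)) mem_nth.
by rewrite /singular_value nth_default.
Qed.

Lemma singular_value_default X i : (n1 <= i)%N -> singular_value X i = 0.
Proof. by move=> n1i; rewrite /singular_value nth_default ?size_singular_values. Qed.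

Lemma singular_value_nincr X i j :
  (i <= j)%N -> singular_value X j <= singular_value X i.
Proof.
move=> ij; have [jn|nj] := ltnP j n1; last first.
  by rewrite (singular_value_default _ nj) singular_value_ge0.
apply: (sorted_leq_nth ge_trans ge_refl) => //.
- exact/sort_sorted/ge_total.
- by rewrite inE size_singular_values (leq_ltn_trans ij).
- by rewrite inE size_singular_values.
Qed.

Lemma char_poly_gram X :
  char_poly (X *m X^T) = \prod_(i < n1) ('X - (singular_value X i ^+ 2)%:P).
Proof.
have [s s_ge0 Xs] := gram_spectrum X.
rewrite Xs -(perm_big _ (perm_singular_values Xs s_ge0)) /= (big_nth 0).
by rewrite size_singular_values big_mkord.
Qed.

Lemma nuclear_norm_spectrum X (s : 'I_n1 -> R) :
  char_poly (X *m X^T) = \prod_i ('X - (s i ^+ 2)%:P) ->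
  (forall i, 0 <= s i) -> nuclear_norm X = \sum_i s i.
Proof.
move=> Xs s_ge0; have s_perm : perm_eq (singular_values X) [tuple s i | i < n1].
  apply: perm_singular_values => [|x /mapP[i _ ->] //].
  by rewrite Xs big_tuple; apply: eq_bigr => i _; rewrite tnth_mktuple.
transitivity (\sum_(x <- singular_values X) x).
  by rewrite (big_nth 0) size_singular_values big_mkord.
rewrite (perm_big _ s_perm) big_tuple.
by apply: eq_bigr => i _; rewrite tnth_mktuple.
Qed.

(** Unlike X X^T, this symmetric matrix is linear in X, so eigenvalue inequalities
    for a difference of dilations are inequalities about X - Y. *)
Definition dilation X : 'M[R]_(n1 + n2) := block_mx 0 X X^T 0.

Lemma dilation_sym X : (dilation X)^T = dilation X.
Proof. by rewrite tr_block_mx !trmx0 trmxK. Qed.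

Lemma dilationB X Y : dilation (X - Y) = dilation X - dilation Y.
Proof. by rewrite /dilation opp_block_mx add_block_mx !subr0 linearB. Qed.

(** Right multiplication by [[t, 0], [X^T, 1]] makes t - dilation X block upper
    triangular, with diagonal blocks t^2 - X X^T and t.  Keeping the factor t^n1
    on the left avoids any division. *)
Lemma char_poly_dilation X :
  char_poly (dilation X) * 'X^n1
  = (\prod_(i < n1) ('X^2 - (singular_value X i ^+ 2)%:P)) * 'X^n2.
Proof.
pose P : 'M[{poly R}]_(n1, n2) := map_mx polyC X.
have -> : \prod_(i < n1) ('X^2 - (singular_value X i ^+ 2)%:P)
          = \det ('X^2%:M - P *m P^T).
  have := congr1 (comp_poly 'X^2) (char_poly_gram X).
  rewrite rmorph_prod /= => prodE.
  transitivity (\prod_(i < n1) (('X - (singular_value X i ^+ 2)%:P) \Po 'X^2)).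
    by apply: eq_bigr => i _; rewrite comp_polyB comp_polyX comp_polyC.
  rewrite -prodE -det_map_mx; congr (\det _).
  rewrite /P map_trmx -map_mxM /char_poly_mx map_mxB map_scalar_mx /= comp_polyX.
  by rewrite -map_mx_comp; congr (_ - _); apply: eq_map_mx => t /=; rewrite comp_polyC.
have -> : 'X^n1 = \det (block_mx 'X%:M 0 P^T 1%:M : 'M[{poly R}]_(n1 + n2)).
  by rewrite det_lblock det1 mulr1 det_scalar.
have -> : 'X^n2 = \det ('X%:M : 'M[{poly R}]_n2) by rewrite det_scalar.
rewrite -(det_ublock _ (- P)) /char_poly -det_mulmx; congr (\det _).
rewrite /char_poly_mx /dilation map_block_mx !map_mx0 -map_trmx -/P.
rewrite scalar_mx_block opp_block_mx add_block_mx !(oppr0, add0r, addr0).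
rewrite mulmx_block !(mulmx0, mulmx1, add0r, addr0) mulNmx -scalar_mxM -expr2.
by congr block_mx; rewrite mulNmx mul_mx_scalar mul_scalar_mx addNr.
Qed.

End SingularValues.

(** When s vanishes from n1 on, the sequence s_i - s_(n1 + n2 - 1 - i) consists of
    the s_i, then n2 - n1 zeros, then the - s_i in reverse order.  It
    serves for products of linear factors and for sums of absolute values. *)
Lemma big_antisymmetrized (T : Type) (idx : T) (op : Monoid.com_law idx)
    (W : zmodType) n1 n2 (s : nat -> W) (F : W -> T) :
  (n1 <= n2)%N -> (forall i, (n1 <= i)%N -> s i = 0) ->
  \big[op/idx]_(i < n1 + n2) F (s i - s (rev_ord i))
  = op (\big[op/idx]_(i < n1) op (F (s i)) (F (- s i)))
       (\big[op/idx]_(i < n2 - n1) F 0).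
Proof.
move=> n12 s0; rewrite big_split_ord big_split /= -Monoid.mulmA; congr (op _ _).
  apply: eq_bigr => i _; rewrite [s (_ - _)%N]s0 ?subr0 //.
  have := ltn_ord i; lia.
transitivity (\big[op/idx]_(i < n2) F (- s i)).
  rewrite (reindex_inj rev_ord_inj) /=; apply: eq_bigr => i _.
  have i_n2 := ltn_ord i; rewrite s0 ?leq_addr // sub0r; congr (F (- s _)); lia.
rewrite -(big_mkord xpredT (fun i => F (- s i))) (big_cat_nat (leq0n n1) n12) /=.
rewrite big_mkord; congr (op _ _).
rewrite -{1}[n1]add0n big_addn big_mkord.
by apply: eq_bigr => i _; rewrite s0 ?oppr0 // leq_addl.
Qed.

(** One of the two terms always vanishes when n1 <= n2, so this lists s_0, s_1,
    ..., zeros, ..., - s_1, - s_0.  Written as a difference of a nonincreasing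
    and a nondecreasing sequence, it is visibly nonincreasing. *)
Definition dilation_eigenvalues (R : realType) (n1 n2 : nat)
    (X : 'M[R]_(n1, n2)) : 'rV[R]_(n1 + n2) :=
  \row_i (singular_value X i - singular_value X (rev_ord i)).

Lemma dilation_eigenvalues_nincr (R : realType) n1 n2 (X : 'M[R]_(n1, n2)) :
  {homo dilation_eigenvalues X 0 : i j / (i <= j)%N >-> j <= i}.
Proof.
move=> i j ij; rewrite !mxE lerB // singular_value_nincr //=.
by rewrite leq_sub2l.
Qed.

Lemma dilation_spectrum (R : realType) n1 n2 (X : 'M[R]_(n1, n2)) :
  (n1 <= n2)%N -> char_poly (dilation X)
  = \prod_i ('X - (dilation_eigenvalues X 0 i)%:P).
Proof.
move=> n12; have X0 : ('X^n1 : {poly R}) != 0 by rewrite expf_neq0 ?polyX_eq0.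
apply: (mulIf X0); rewrite char_poly_dilation.
under [in RHS]eq_bigr do rewrite mxE.
rewrite (big_antisymmetrized _ (fun t => 'X - t%:P)) //; last first.
  exact: singular_value_default.
rewrite subr0 prodr_const card_ord -mulrA -exprD subnK //; congr (_ * _).
by apply: eq_bigr => i _; rewrite polyCN opprK polyC_exp subr_sqr.
Qed.

(** Both sides of the eigenvalue inequality for the dilations are twice those
    claimed here, each singular value being counted once with either sign. *)
Theorem singular_value_perturbation (R : realType) n1 n2 (X Y : 'M[R]_(n1, n2)) :
  (n1 <= n2)%N ->
  \sum_(i < n1) `|singular_value X i - singular_value Y i| <= nuclear_norm (X - Y).
Proof.
move=> n12.
have := eigenvalue_perturbation (dilation_sym X) (dilation_sym Y)
  (dilation_spectrum X n12) (dilation_spectrum Y n12).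
rewrite -dilationB => /(_ _ (dilation_spectrum (X - Y) n12)).
move=> /(_ (@dilation_eigenvalues_nincr _ _ _ X)).
move=> /(_ (@dilation_eigenvalues_nincr _ _ _ Y)).
under [leLHS]eq_bigr do rewrite !mxE.
under [leRHS]eq_bigr do rewrite mxE.
rewrite (big_antisymmetrized _ Num.norm) //; last first.
  exact: singular_value_default.
(* The difference of the two lists of eigenvalues is itself antisymmetrized from
   s_i(X) - s_i(Y). *)
pose st i := singular_value X i - singular_value Y i.
have st0 i : (n1 <= i)%N -> st i = 0.
  by move=> n1i; rewrite /st !singular_value_default ?subrr.
under [leLHS]eq_bigr => i _.
  rewrite (_ : _ - _ = st i - st (rev_ord i)); last by rewrite /st; ring.
  over.
rewrite (big_antisymmetrized _ Num.norm) //.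
under [in leLHS]eq_bigr do rewrite /= normrN -mulr2n.
under [in leRHS]eq_bigr do rewrite /= normrN -mulr2n.
rewrite normr0 !big1_eq /= !addr0 !sumrMnl lerMn2r /=.
rewrite /nuclear_norm; under [leRHS]eq_bigr do rewrite ger0_norm ?singular_value_ge0 //.
by [].
Qed.

(** * Nuclear norms and the recovery estimate *)

Lemma singular_valuesN (R : realType) n1 n2 (X : 'M[R]_(n1, n2)) :
  singular_values (- X) = singular_values X.
Proof. by rewrite /singular_values linearN /= mulNmx mulmxN opprK. Qed.

Lemma nuclear_norm0 (R : realType) n1 n2 : nuclear_norm (0 : 'M[R]_(n1, n2)) = 0.
Proof.
rewrite (@nuclear_norm_spectrum _ _ _ _ (fun=> 0)) ?big1_eq //.
rewrite mul0mx char_poly_trig; last exact: is_diag_mx_is_trig (@mx0_is_diag _ _ _).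
by apply: eq_bigr => i _; rewrite mxE expr0n.
Qed.

Lemma svd_sumE (R : realType) n1 n2 (X : 'M[R]_(n1, n2)) U V k :
  svd_sum X U V k
  = U *m diag_mx (\row_i (if (i < k)%N then singular_value X i else 0)) *m V^T.
Proof.
apply/matrixP => i j; rewrite summxE big_mkcond /= mul_mx_diag mxE.
apply: eq_bigr => l _; rewrite !mxE; case: ifP => _; rewrite ?mulr0 ?mul0r //.
by rewrite big_ord1 !mxE; ring.
Qed.

(** The tail of the decomposition is U diag(s) V^T with the first k entries of s
    set to 0, and its Gram matrix U diag(s^2) U^T exhibits the factorization that
    determines its singular values. *)
Lemma nuclear_norm_svd_tail (R : realType) n1 n2 (X : 'M[R]_(n1, n2)) U V k :
  is_svd X U V ->
  nuclear_norm (X - svd_sum X U V k)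
  = \sum_(i < n1) if (i < k)%N then 0 else singular_value X i.
Proof.
case=> UU VV XE; pose s (i : 'I_n1) := if (i < k)%N then 0 else singular_value X i.
have tailE : X - svd_sum X U V k = U *m diag_mx (\row_i s i) *m V^T.
  rewrite {1}XE !svd_sumE -mulmxBl -mulmxBr -raddfB; congr (_ *m diag_mx _ *m _).
  by apply/rowP => i; rewrite !mxE ltn_ord /s; case: ifP; rewrite ?subrr ?subr0.
apply: nuclear_norm_spectrum => [|i]; last first.
  by case: ifP => // _; apply: singular_value_ge0.
have -> : (X - svd_sum X U V k) *m (X - svd_sum X U V k)^T
          = U^T^T *m diag_mx (\row_i (s i ^+ 2)) *m U^T.
  rewrite tailE !trmx_mul !trmxK tr_diag_mx !mulmxA -(mulmxA _ V^T) VV mulmx1.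
  rewrite -(mulmxA U) mulmx_diag; congr (_ *m diag_mx _ *m _).
  by apply/rowP => i; rewrite !mxE expr2.
rewrite orthogonal_diag_char_poly; last by rewrite trmxK (mulmx1C UU).
by apply: eq_bigr => i _; rewrite mxE.
Qed.

(** Cauchy-Schwarz against the constant sequence, from the nonnegativity of the
    sum of the squared deviations k w_i - S, where S is the sum of the w_i. *)
Lemma sqr_sum_le (R : realDomainType) k (w : nat -> R) :
  (\sum_(i < k) w i) ^+ 2 <= k%:R * \sum_(i < k) w i ^+ 2.
Proof.
case: k => [|k]; first by rewrite !big_ord0 expr0n mulr0.
set S := \sum_(i < _) w i; set Q := \sum_(i < _) w i ^+ 2.
have : 0 <= \sum_(i < k.+1) (k.+1%:R * w i - S) ^+ 2.
  by apply: sumr_ge0 => i _; apply: sqr_ge0.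
have -> : \sum_(i < k.+1) (k.+1%:R * w i - S) ^+ 2
          = k.+1%:R * (k.+1%:R * Q - S ^+ 2).
  transitivity (\sum_(i < k.+1)
    (k.+1%:R ^+ 2 * w i ^+ 2 - (2 * k.+1%:R * S) * w i + S ^+ 2)).
    by apply: eq_bigr => i _; ring.
  rewrite big_split sumrB /= -!mulr_sumr -/S -/Q sumr_const card_ord -mulr_natl.
  by ring.
by rewrite pmulr_rge0 ?ltr0Sn // subr_ge0.
Qed.

Theorem theorem2 (R : realType) (n1 n2 m k : nat)
    (n1_gt0 : (0 < n1)%N) (n12 : (n1 <= n2)%N) (m_gt0 : (0 < m)%N)
    (k_gt0 : (0 < k)%N) (kn1 : (k <= n1)%N)
    (A : {linear 'M[R]_(n1, n2) -> 'cV[R]_m}) (Delta : R)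
    (hA : spherical_section A Delta) (hDelta : 4 * k%:R < Delta)
    (X0 Xstar X0k : 'M[R]_(n1, n2))
    (hX0k : is_svd_truncation X0 k X0k)
    (hAX : A Xstar = A X0)
    (hX : nuclear_norm Xstar <= nuclear_norm X0) :
  nuclear_norm (Xstar - X0) <=
    2 / (1 - 2 * Num.sqrt (k%:R / Delta)) * nuclear_norm (X0 - X0k).
Proof.
have [U [V [svdX0 ->]]] := hX0k.
rewrite (nuclear_norm_svd_tail _ svdX0).
set W := Xstar - X0; set N := nuclear_norm W.
set tail := \sum_(i < n1) _; set r := Num.sqrt _.
pose w i := singular_value W i; pose x i := singular_value X0 i.
pose head := \sum_(i < k) w i.
have k_pos : 0 < k%:R :> R by rewrite ltr0n.
have Delta_gt0 : 0 < Delta by apply: lt_trans hDelta; rewrite mulr_gt0.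
have w_ge0 i : 0 <= w i by apply: singular_value_ge0.
have N_ge0 : 0 <= N by apply: sumr_ge0 => i _; apply: w_ge0.
have headE : head = \sum_(i < n1) if (i < k)%N then w i else 0.
  by rewrite /head (big_ord_widen _ _ kn1) big_mkcond.
(* Perturbation inequality for X0 and - W, each absolute value being bounded
   below by the signed difference that is favourable on its side of k. *)
have head_tail : N <= 2 * head + 2 * tail.
  have := singular_value_perturbation X0 (- W) n12.
  have -> : X0 - - W = Xstar by rewrite opprK addrC subrK.
  move/le_trans/(_ hX).
  have wN i : singular_value (- W) i = w i
    by rewrite /w /singular_value singular_valuesN.
  rewrite -subr_ge0 /nuclear_norm -sumrB => diff_ge0.
  rewrite headE -subr_ge0 /N /nuclear_norm !mulr_sumr -big_split -sumrB /=.
  apply: le_trans diff_ge0 _; apply: ler_sum => i _; rewrite wN -/(w i) -/(x i).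
  by case: ifP => _; have := ler_norm (x i - w i); have := ler_norm (w i - x i);
     rewrite distrC; lra.
(* Cauchy-Schwarz and the spherical section property; the latter says nothing
   when W = 0, where both sides vanish. *)
have head_le : head <= r * N.
  have [W0|W0] := eqVneq W 0.
    have N0 : N = 0 by rewrite /N W0 nuclear_norm0.
    rewrite N0 mulr0 -N0 headE; apply: ler_sum => i _.
    by case: ifP => // _; apply: w_ge0.
  have AW : A W = 0 by rewrite linearB /= hAX subrr.
  have := hA _ W0 AW; set F := frobenius_norm W; rewrite -/N => hN.
  have Q_ge0 : 0 <= \sum_(i < n1) w i ^+ 2
    by apply: sumr_ge0 => i _; apply: sqr_ge0.
  have F2 : F ^+ 2 = \sum_(i < n1) w i ^+ 2 by rewrite sqr_sqrtr.
  (* If F vanished, the quotient in the spherical section property would be 0,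
     below Delta. *)
  have F2_gt0 : 0 < F ^+ 2.
    rewrite lt_def sqr_ge0 andbT; apply: contraTneq hN => ->.
    by rewrite invr0 mulr0 -ltNge.
  have rN_ge0 : 0 <= r * N by rewrite mulr_ge0 ?sqrtr_ge0.
  rewrite -(ler_pXn2r (ltn0Sn 1)) ?nnegrE //; last exact: sumr_ge0.
  apply: le_trans (sqr_sum_le k w) _.
  have le_F : \sum_(i < k) w i ^+ 2 <= F ^+ 2.
    rewrite F2 (big_ord_widen _ (fun i => w i ^+ 2) kn1) big_mkcond /=.
    by apply: ler_sum => i _; case: ifP => // _; apply: sqr_ge0.
  rewrite exprMn sqr_sqrtr; last by rewrite divr_ge0 // ltW.
  rewrite -mulrA ler_pM2l //.
  apply: le_trans le_F _; rewrite mulrC ler_pdivlMr //.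
  by rewrite mulrC -ler_pdivlMr.
have r_lt : r < 2^-1.
  have half_gt0 : 0 < 2^-1 :> R by rewrite invr_gt0.
  rewrite -[ltRHS]ger0_norm ?(ltW half_gt0) // -sqrtr_sqr ltr_sqrt ?exprn_gt0 //.
  by rewrite ltr_pdivrMr //; lra.
have gap : 0 < 1 - 2 * r by lra.
rewrite mulrAC ler_pdivlMr //; lra.
Qed.
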